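(* Let $m,n$ be positive integers. Let $0<\lambda_1<\cdots<\lambda_n$ and $0<\mu_1<\cdots<\mu_n$ be real numbers such that $\mu_{i+1}-\mu_i$ is a positive integer for all $1\le i\le n-1$. Then the $n\times n$ matrices $$\left[\frac{1}{(\Gamma(\lambda_i+\mu_j))^m}\right]_{i,j=1}^n\quad\text{and}\quad \left[\beta(\lambda_i,\mu_j)^m\right]_{i,j=1}^n$$ are nonsingular.
   Context: $\Gamma$ is the gamma function and, for $x,y>0$, $\beta(x,y)=\frac{\Gamma(x)\Gamma(y)}{\Gamma(x+y)}$ is the beta function. The powers are entrywise: the $(i,j)$th entries are $1/\Gamma(\lambda_i+\mu_j)^m$ and $(\beta(\lambda_i,\mu_j))^m$, respectively. *)

(* Defs.v *)
From HB Require Import structures.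
From mathcomp Require Import all_boot all_order all_algebra.
From mathcomp Require Import all_classical all_reals all_analysis.
Set Implicit Arguments.
Unset Strict Implicit.
Unset Printing Implicit Defensive.
Import Order.TTheory GRing.Theory Num.Theory.
Local Open Scope classical_set_scope.
Local Open Scope ring_scope.

(* Euler's integral of the second kind. It converges exactly when 0 < x, and
   only such arguments are meaningful; for x <= 0 the value is junk, because
   Rintegral sends an infinite integral to 0. *)
Definition Gamma (R : realType) (x : R) : R :=
  \int[@lebesgue_measure R]_(t in `]0, +oo[) (t `^ (x - 1) * expR (- t)).

Definition Beta (R : realType) (x y : R) : R :=
  Gamma x * Gamma y / Gamma (x + y).

(* Main.v *)
Require Import Defs.
From mathcomp Require Import all_boot all_order all_algebra.
From mathcomp Require Import all_classical all_reals all_analysis.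
From mathcomp Require Import measurable_realfun lra zify ring.
Set Implicit Arguments.
Unset Strict Implicit.
Unset Printing Implicit Defensive.
Import Order.TTheory GRing.Theory Num.Theory.
Local Open Scope ring_scope.

(* Since Gamma (x + k) = Gamma x * x (x + 1) ... (x + k - 1), a vector c in the
   kernel of the first matrix makes P = sum_j c_j (Gamma (X + mu_n) / Gamma (X + mu_j)) ^ m
   a polynomial with the n distinct positive roots lambda_i. The summands have
   different degrees, so P <> 0, and P is obtained from a constant by alternately
   multiplying by factors X + a with a > 0, which does not increase the number of
   sign changes of the coefficients, and adding a constant, which increases it by at
   most one. Hence P has at most n - 1 sign changes, contradicting Descartes' rule.
   The second matrix is obtained from the first by scaling rows and columns. *)

(* For k > 0: f has at least k - 1 sign changes at indices >= N, zero values being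
   ignored, and the first of the k signs is (-1) ^ b. *)
Fixpoint alternates (R : realFieldType) (f : nat -> R) (b : bool) (N k : nat) : Prop :=
  if k is k'.+1 then
    exists2 i, (N <= i)%N & 0 < (-1) ^+ b * f i /\ alternates f (~~ b) i.+1 k'
  else True.

(** * Sign alternation of sequences and of polynomial coefficients *)

Section Alternation.
Variable R : realFieldType.
Implicit Types (f h : nat -> R) (p q : {poly R}) (b : bool) (N k : nat).

Lemma alternatesW f b M N k :
  (M <= N)%N -> alternates f b N k -> alternates f b M k.
Proof.
by case: k => //= k le_MN [i le_Ni alt_i]; exists i => //; apply: leq_trans le_Ni.
Qed.

Lemma sgn_alternates f h d b N k :
  (forall c i, (N <= i)%N -> 0 < (-1) ^+ c * f i -> 0 < (-1) ^+ c * h (i + d)%N) ->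
  alternates f b N k -> alternates h b (N + d) k.
Proof.
elim: k b N => //= k IHk b N sgn_fh [i le_Ni [fi_gt0 alt_f]].
exists (i + d)%N; [by rewrite leq_add2r | split; first exact: sgn_fh].
apply: IHk alt_f => c j lt_ij; apply: sgn_fh.
exact: leq_trans le_Ni (ltnW lt_ij).
Qed.

(** The index [N] cannot be the first one selected, since [f N] has the wrong sign. *)
Lemma alternatesS f b N k :
  0 < (-1) ^+ b * f N -> alternates f (~~ b) N k -> alternates f (~~ b) N.+1 k.
Proof.
case: k => //= k fN_gt0 [i le_Ni [fi_gt0 alt_f]]; exists i => //.
rewrite ltn_neqAle le_Ni andbT; apply: contraTneq fi_gt0 => <-.
by rewrite signrN mulNr oppr_gt0 -leNgt ltW.
Qed.

(** Coefficient i of the product is p_{i-1} + a p_i, so p_i or p_{i-1} shares its sign. Each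
    selected index moves down by at most one, hence [N.-1]. *)
Lemma alternates_mulXDC p a b N k : 0 < a ->
  alternates (fun i => (('X + a%:P) * p)`_i) b N k ->
  alternates (fun i => p`_i) b N.-1 k.
Proof.
move=> a_gt0; elim: k b N => //= k IHk b N [i le_Ni [sgn_i /IHk /= alt_p]].
have [pi_gt0|pi_le0] := ltP 0 ((-1) ^+ b * p`_i).
  (* When [i] itself is kept, induction only places the later indices at or above [i]; [alternatesS]
     excludes [i]. *)
  by exists i; [lia | split=> //; exact: alternatesS].
have : 0 < (-1) ^+ b * ('X * p)`_i.
  by move: sgn_i; rewrite mulrDl coefD coefCM; nra.
rewrite coefXM; case: i le_Ni {sgn_i pi_le0} alt_p => [|i] le_Ni alt_p.
  by rewrite mulr0 ltxx.
by move=> pi_gt0; exists i; [lia | split].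
Qed.

Lemma alternates_mul_prodXDC (s : seq R) p b N k : all (>%R^~ 0) s ->
  alternates (fun i => ((\prod_(a <- s) ('X + a%:P)) * p)`_i) b N k ->
  alternates (fun i => p`_i) b 0 k.
Proof.
elim: s N => [|a s IHs] N /=; first by rewrite big_nil mul1r => _; apply: alternatesW.
case/andP=> a_gt0 s_gt0; rewrite big_cons -mulrA => /(alternates_mulXDC a_gt0).
exact: IHs.
Qed.

(** The constant affects coefficient 0 only, and dropping the first selected index leaves positive
    ones. *)
Lemma alternates_addC p c b N k :
  alternates (fun i => (p + c%:P)`_i) b N k.+1 ->
  exists b', alternates (fun i => p`_i) b' 0 k.
Proof.
case=> i _ [_ alt_p]; exists (~~ b); apply: (@alternatesW _ _ 0 (i.+1 + 0)) => //.
apply: sgn_alternates alt_p => b' j; rewrite coefD coefC addn0.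
by case: j => //= j _; rewrite addr0.
Qed.

(** * Descartes' rule of signs *)

Lemma descent h b i j : (i <= j)%N ->
  (-1) ^+ b * h j < (-1) ^+ b * h i ->
  exists2 l, (i <= l < j)%N & 0 < (-1) ^+ b * (h l - h l.+1).
Proof.
move=> /subnKC <-; elim: (j - i)%N => [|d IHd]; first by rewrite addn0 ltxx.
have [lt_h _|le_h lt_h] := ltP ((-1) ^+ b * h (i + d)%N) ((-1) ^+ b * h i).
  by have [l ? ?] := IHd lt_h; exists l => //; lia.
exists (i + d)%N; first lia.
by rewrite mulrBr subr_gt0 -addnS (lt_le_trans lt_h).
Qed.

(** Between consecutive selected indices [h] changes sign, so some single difference has the sign of
    the earlier value; past the last index, the eventual value 0 supplies one more difference. *)
Lemma alternates_diff h b N i k :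
  (forall j, (N <= j)%N -> h j = 0) ->
  0 < (-1) ^+ b * h i -> alternates h (~~ b) i.+1 k ->
  alternates (fun i => h i - h i.+1) b i k.+1.
Proof.
move=> h0; elim: k b i => [|k IHk] b i hi_gt0.
  move=> _; have [| |l] := @descent h b i (i + N)%N; first exact: leq_addr.
    by rewrite h0 ?leq_addl // mulr0.
  by case/andP=> le_il _ hl; exists l.
case=> j lt_ij [hj_gt0 /(IHk _ _ hj_gt0) alt_h].
have [|l] := @descent h b i j (ltnW lt_ij).
  by move: hj_gt0; rewrite signrN mulNr; lra.
case/andP=> le_il lt_lj hl; exists l => //; split=> //.
exact: alternatesW alt_h.
Qed.

(* With [h i = a ^ i * ('X * p)`_i] one has [a ^ i * (('X - a) * p)`_i = h i - h i.+1],
   and [h] vanishes both at [0] and at infinity. *)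
Lemma alternates_mulXBC p a b N k : 0 < a ->
  alternates (fun i => p`_i) b N k.+1 ->
  alternates (fun i => (('X - a%:P) * p)`_i) (~~ b) 0 k.+2.
Proof.
move=> a_gt0 alt_p; pose h i := a ^+ i * ('X * p)`_i.
have {alt_p} : alternates h b (N + 1) k.+1.
  apply: sgn_alternates alt_p => c i _ pi_gt0.
  by rewrite /h coefXM addn1 /= mulrCA pmulr_rgt0 // exprn_gt0.
case=> i _ [hi_gt0 alt_h].
have h0 j : (size ('X * p)%R <= j)%N -> h j = 0.
  by move=> le_pj; rewrite /h nth_default ?mulr0.
have /(alternates_diff h0 hi_gt0) {}alt_h := alt_h.
(* The extra alternation: passing from [h 0 = 0] to [h i] forces a difference of the opposite sign
   before [i]. *)
have [|j /andP[_ lt_ji] hj_gt0] := @descent h (~~ b) 0 i (leq0n i).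
  by rewrite signrN !mulNr [h 0]/h coefXM /= !mulr0 oppr0 oppr_lt0.
have {}alt_h : alternates (fun i => h i - h i.+1) (~~ b) 0 k.+2.
  by exists j => //; rewrite negbK; split=> //; apply: alternatesW alt_h.
rewrite -[0%N]addn0; apply: sgn_alternates alt_h => c l _.
rewrite addn0 /h mulrBl coefB coefCM [('X * p)`_l.+1]coefXM /= exprSr -mulrA -mulrBr.
by rewrite mulrCA pmulr_rgt0 // exprn_gt0.
Qed.

(** The leading coefficient starts the induction and each factor ['X - a%:P] adds one alternation;
    distinctness makes the other roots roots of the cofactor. *)
Lemma Descartes_rule_of_signs p (s : seq R) : p != 0 -> uniq s -> all (>%R^~ 0) s ->
  all (root p) s -> exists b, alternates (fun i => p`_i) b 0 (size s).+1.
Proof.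
elim: s p => [|a s IHs] p p_neq0 /=.
  move=> _ _ _; have lead_neq0 : p`_(size p).-1 != 0 by rewrite -lead_coefE lead_coef_eq0.
  exists (p`_(size p).-1 < 0); exists (size p).-1 => //; split=> //.
  by rewrite -normrEsign normr_gt0.
case/andP=> a_notin uniq_s /andP[a_gt0 s_gt0] /andP[/factor_theorem[q Dp] root_s].
move: p_neq0; rewrite Dp mulf_eq0 negb_or => /andP[q_neq0 _].
have [|b alt_q] := IHs q q_neq0 uniq_s s_gt0.
  apply/allP => x s_x; have := allP root_s x s_x.
  rewrite Dp rootM root_XsubC => /orP[//|/eqP eq_xa].
  by rewrite -eq_xa s_x in a_notin.
by exists (~~ b); rewrite mulrC; apply: alternates_mulXBC alt_q.
Qed.

(** * Nested polynomials and the nonsingularity criterion *)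

(** Horner-like nesting of \sum_j c_j \prod_{j <= l < n} \prod_{a in s_l} (X + a): the constants
    enter one at a time, each costing at most one sign change. *)
Fixpoint chain (c : nat -> R) (s : nat -> seq R) n : {poly R} :=
  if n is n'.+1 then (\prod_(a <- s n') ('X + a%:P)) * chain c s n' + (c n)%:P
  else (c 0)%:P.

Lemma chain_alternates c s n b N : (forall i, (i < n)%N -> all (>%R^~ 0) (s i)) ->
  ~ alternates (fun i => (chain c s n)`_i) b N n.+2.
Proof.
elim: n b N => [|n IHn] b N s_gt0.
  case=> i _ [ci_gt0] [j lt_ij [cj_gt0 _]].
  by move: cj_gt0; rewrite /= coefC; case: j lt_ij => //= j _; rewrite mulr0 ltxx.
case/alternates_addC=> b' /alternates_mul_prodXDC /= alt_c.
by apply: (IHn _ _ _ (alt_c _)) => [i lt_in|]; apply: s_gt0; rewrite // ltnW.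
Qed.

(** By degrees: a nonzero inner chain times a product of positive degree cannot cancel against a
    constant. *)
Lemma chain_eq0 c s n : (forall i, (i < n)%N -> (0 < size (s i))%N) ->
  chain c s n = 0 -> forall i, (i <= n)%N -> c i = 0.
Proof.
elim: n => [|n IHn] s_neq0 /=.
  by move/polyC_inj=> c0 i; rewrite leqn0 => /eqP->.
set r := \prod_(a <- _) _.
have size_r : size r = (size (s n)).+1.
  by rewrite -(size_prod_XsubC (s n) -%R) /r; under [in RHS]eq_bigr do rewrite polyCN opprK.
have [chain0 | chain_neq0] := eqVneq (chain c s n) 0.
  rewrite chain0 mulr0 add0r => /polyC_inj cn0 i; rewrite leq_eqVlt => /predU1P[-> //|].
  by move=> le_in; apply: IHn => // j lt_jn; apply: s_neq0; rewrite ltnW.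
move=> /eqP; rewrite addr_eq0 -polyCN => /eqP/(congr1 (size \o val)) /=.
rewrite size_mul // -?size_poly_gt0 size_r // size_polyC.
have := s_neq0 n (ltnSn n); move: chain_neq0; rewrite -size_poly_gt0.
move: (size (chain c s n)) (size (s n)) => [|u] [|w] // _ _.
by case: (_ != _); rewrite addSn addnS.
Qed.

(** The ratio [g n / g i] telescopes into the linear factors evaluated at [x]. *)
Lemma horner_chain c s n x (g : nat -> R) :
  (forall i, (i <= n)%N -> g i != 0) ->
  (forall i, (i < n)%N -> g i.+1 = g i * \prod_(a <- s i) (x + a)) ->
  (chain c s n).[x] = g n * \sum_(i < n.+1) c i / g i.
Proof.
elim: n => [|n IHn] g_neq0 gS.
  by rewrite /= hornerC big_ord1 mulrCA divff ?mulr1 ?g_neq0.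
rewrite /= hornerD hornerM IHn; first last.
- by move=> i lt_in; apply: gS; rewrite ltnW.
- by move=> i le_in; apply: g_neq0; rewrite ltnW.
rewrite hornerC [in RHS]big_ord_recr /= [in RHS]mulrDr.
rewrite [X in _ = _ + X]mulrCA divff ?mulr1 ?g_neq0 // gS // horner_prod.
rewrite mulrA [in LHS](mulrC _ (g n)); congr (_ * _ * _ + _).
by apply: eq_bigr => a _; rewrite hornerD hornerX hornerC.
Qed.

Lemma unitmx_chain n (x : 'I_n.+1 -> R) (s : nat -> seq R) (g : 'I_n.+1 -> nat -> R) :
  injective x -> (forall i, 0 < x i) ->
  (forall j, (j < n)%N -> (0 < size (s j))%N) ->
  (forall j, (j < n)%N -> all (>%R^~ 0) (s j)) ->
  (forall i j, (j <= n)%N -> g i j != 0) ->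
  (forall i j, (j < n)%N -> g i j.+1 = g i j * \prod_(a <- s j) (x i + a)) ->
  \matrix_(i < n.+1, j < n.+1) (g i j)^-1 \in unitmx.
Proof.
move=> x_inj x_gt0 s_neq0 s_gt0 g_neq0 gS.
(* [det0P] gives a row vector acting from the left; transposing makes it a kernel vector of the
   original matrix. *)
rewrite -unitmx_tr unitmxE unitfE; apply/det0P => -[v v_neq0 vA0].
pose c j := v 0 (inord j).
have root_x i : root (chain c s n) (x i).
  apply/rootP; rewrite (@horner_chain c s n (x i) (g i)); [|exact: g_neq0|exact: gS].
  have /matrixP/(_ 0 i) := vA0; rewrite !mxE => sum0.
  rewrite (_ : \sum_(_ < _) _ = 0) ?mulr0 // -[RHS]sum0.
  by apply: eq_bigr => j _; rewrite !mxE /c inord_val.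
have chain_neq0 : chain c s n != 0.
  apply: contraNneq v_neq0 => /(chain_eq0 s_neq0) c0; apply/eqP/rowP => j.
  by have := c0 j (ltn_ord j); rewrite /c inord_val mxE.
(* The n + 1 positive roots force n + 2 alternating coefficients, one more than [chain_alternates]
   allows. *)
have [|||b] := @Descartes_rule_of_signs (chain c s n) (map x (enum 'I_n.+1)) chain_neq0.
- by rewrite map_inj_uniq ?enum_uniq.
- by apply/allP => _ /mapP[i _ ->]; exact: x_gt0.
- by apply/allP => _ /mapP[i _ ->]; exact: root_x.
by rewrite size_map size_enum_ord => /chain_alternates; apply.
Qed.

End Alternation.

(** * Functional equation, finiteness and positivity of the gamma function *)

Section GammaRecurrence.
Import numFieldNormedType.Exports.
Local Open Scope classical_set_scope.
Variable R : realType.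
Implicit Types (x t : R) (k : nat).
Local Notation mu := (@lebesgue_measure R).

Let f x t := t `^ (x - 1) * expR (- t).

Let f_ge0 x t : 0 <= f x t.
Proof. by rewrite mulr_ge0 ?powR_ge0 ?expR_ge0. Qed.

Let f_is_derive x t : 0 < t -> is_derive t 1 (f (x + 1)) (x * f x t - f (x + 1) t).
Proof.
move=> t_gt0; have d1 := @is_derive1_powR _ x t t_gt0.
have d2 : is_derive t 1 (fun u => expR (- u)) (- expR (- t)).
  have := @is_derive1_comp R expR (fun u => - u) t (expR (- t)) (-1) _ _.
  by rewrite mulrN1; apply.
have -> : f (x + 1) = (@powR R ^~ x) * (fun u => expR (- u)).
  by apply/funext => u; rewrite /f addrK.
apply: is_derive_eq.
rewrite -[X in _ = _ - X]/(t `^ x * expR (- t)) /f /GRing.scale /=.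
ring.
Qed.

Let measurable_f x : measurable_fun [set: R] (f x).
Proof.
by apply: measurable_funM => //; apply: measurableT_comp => //; exact: measurable_oppr.
Qed.

Let emeasurable_f x (A : set R) : measurable_fun A (EFin \o f x).
Proof. by apply: measurable_funTS; apply/measurable_EFinP. Qed.

Let f_continuous x t : 0 < t -> {for t, continuous (f x)}.
Proof.
move=> t_gt0; apply/differentiable_continuous/derivable1_diffP.
by have [] := f_is_derive (x - 1) t_gt0; rewrite subrK.
Qed.

(** Compact sets away from 0, where the integrand is continuous even for x < 1. The endpoint [k.+2]
    keeps [window 0], which is [1, 2], nondegenerate. *)
Definition window k : set R := `[k.+1%:R^-1, k.+2%:R].

Let window_gt0 k t : window k t -> 0 < t.
Proof. by rewrite /window /= in_itv /= => /andP[+ _]; apply: lt_le_trans. Qed.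

Let window_bigcup : \bigcup_k window k = `]0, +oo[%classic.
Proof.
apply/seteqP; split=> [t [k _ /window_gt0 t_gt0]|t]; rewrite /= in_itv /= andbT // => t_gt0.
pose k := maxn (Num.bound t) (Num.bound t^-1).
exists k => //=; rewrite /window /= in_itv /=; apply/andP; split.
  rewrite -[leRHS]invrK lef_pV2 ?posrE ?invr_gt0 //; apply/ltW.
  apply: (lt_le_trans (archi_boundP _)); first by rewrite invr_ge0 ltW.
  by rewrite ler_nat leqW ?leq_maxr.
apply/ltW/(lt_le_trans (archi_boundP (ltW t_gt0))).
by rewrite ler_nat !leqW ?leq_maxl.
Qed.

Let window_homo : {homo window : n k / (n <= k)%N >-> (n <= k)%O}.
Proof.
move=> n k le_nk; rewrite subsetEset => t; rewrite /window /= !in_itv /= => /andP[le1 le2].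
apply/andP; split; last by apply: le_trans le2 _; rewrite ler_nat.
by apply: le_trans le1; rewrite lef_pV2 ?posrE // ler_nat.
Qed.

(** Valued in [\bar R] so that the functional equation comes first and then serves to prove
    finiteness. *)
Let eGamma x : \bar R := (\int[mu]_(t in `]0%R, +oo[) (f x t)%:E)%E.

Let window_cvg x :
  (\int[mu]_(t in window k) (f x t)%:E)%E @[k --> \oo] --> eGamma x.
Proof.
rewrite /eGamma -window_bigcup; apply: ge0_nondecreasing_set_cvg_integral => //.
- by move=> k; apply: measurable_itv.
- by move=> k; exact: emeasurable_f.
- by move=> k t _; rewrite lee_fin.
Qed.

Let window_integrable x k : mu.-integrable (window k) (EFin \o f x).
Proof.
apply: continuous_compact_integrable; first exact: segment_compact.
apply: continuous_in_subspaceT => t; rewrite inE => /window_gt0.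
exact: f_continuous.
Qed.

(** Integration by parts: [f (x + 1)] is a primitive of [x * f x - f (x + 1)]. *)
Let window_parts x k : 0 < x ->
  (x%:E * \int[mu]_(t in window k) (f x t)%:E =
   \int[mu]_(t in window k) (f (x + 1) t)%:E +
   (f (x + 1) k.+2%:R - f (x + 1) k.+1%:R^-1)%:E)%E.
Proof.
move=> x_gt0; have lt_w : k.+1%:R^-1 < k.+2%:R :> R.
  by rewrite (@le_lt_trans _ _ 1) ?invf_le1 ?ler1n ?ltr1n.
have df_cont : {within window k, continuous (fun t => x * f x t - f (x + 1) t)}.
  apply: continuous_in_subspaceT => t; rewrite inE => /window_gt0 t_gt0.
  by apply: cvgB; [apply: cvgMr; exact: f_continuous | exact: f_continuous].
rewrite EFinB -(@continuous_FTC2 _ (fun t => x * f x t - f (x + 1) t)) //; last 2 first.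
- have f1_cont t : 0 < t -> f (x + 1) u @[u --> t] --> f (x + 1) t by exact: f_continuous.
  split=> [t||].
  + rewrite in_itv /= => /andP[lt_t _].
    by have [] := @f_is_derive x t (lt_trans _ lt_t).
  + by apply/cvg_at_right_filter/f1_cont.
  + by apply/cvg_at_left_filter/f1_cont.
- move=> t; rewrite in_itv /= => /andP[lt_t _].
  have t_gt0 : 0 < t by apply: lt_trans lt_t.
  by rewrite derive1E; have [_ ->] := f_is_derive x t_gt0.
rewrite -/(window k) -integralD_EFin //.
- rewrite -ge0_integralZl_EFin ?ltW //; first last.
  + exact: emeasurable_f.
  + by move=> t _; rewrite lee_fin.
  + exact: measurable_itv.
  by apply: eq_integral => t _; rewrite /= -EFinM -EFinD addrC subrK.
- exact: measurable_itv.
- by apply: continuous_compact_integrable => //; exact: segment_compact.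
Qed.

Let f1_cvg0 x : 0 < x ->
  (f (x + 1) k.+2%:R - f (x + 1) k.+1%:R^-1) @[k --> \oo] --> (0 : R).
Proof.
move=> x_gt0; rewrite -[X in _ --> X](subrr 0); apply: cvgB; last first.
  suff f1_0 : f (x + 1) t @[t --> 0^'+] --> 0.
    apply: (cvg_at_rightP _ _ _).1 f1_0 _ _; split=> //; exact: cvg_harmonic.
  rewrite -[X in _ --> X](mul0r (expR (- 0))); under eq_fun do rewrite /f addrK.
  apply: cvgM; first exact: powR_cvg0.
  apply/cvg_at_right_filter; apply: continuous_comp; first exact: oppr_continuous.
  exact: continuous_expR.
(* At t = k + 2, the bounds t^x <= t^n and e^t >= t^(n+1) / (n+1)! give at most (n+1)! / t, hence at
   most (n+1)! / (k+1). *)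
pose n := Num.bound x.
apply: (@squeeze_cvgr _ _ _ _ (fun=> 0) (fun k => n.+1`!%:R * harmonic k)).
- near=> k; rewrite f_ge0 /=; set t := _%:R : R.
  have t_ge1 : 1 <= t by rewrite ler1n.
  have t_gt0 : 0 < t by exact: lt_le_trans t_ge1.
  have le_tx : t `^ x <= t ^+ n.
    by rewrite -powR_mulrn ?(ltW t_gt0) //; apply: ler_powR => //; apply/ltW/archi_boundP/ltW.
  have le_exp : t ^+ n.+1 / n.+1`!%:R <= expR t.
    by apply: le_trans (expR_ge1Dxn n (ltW t_gt0)); rewrite lerDr.
  rewrite /f addrK expRN ler_pdivrMr ?expR_gt0 //.
  apply: le_trans le_tx _.
  rewrite -mulrA -ler_pdivrMl ?ltr0n ?fact_gt0 // mulrC.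
  rewrite /harmonic -ler_pdivrMl ?invr_gt0 ?ltr0n // invrK.
  apply: le_trans le_exp; rewrite exprS mulrA ler_pM2r ?invr_gt0 ?ltr0n ?fact_gt0 //.
  by rewrite ler_wpM2r ?exprn_ge0 ?(ltW t_gt0) // ler_nat.
- exact: cvg_cst.
- by rewrite -[X in _ --> X](mulr0 n.+1`!%:R); apply: cvgMr; exact: cvg_harmonic.
Unshelve. all: by end_near. Qed.

Lemma eGammaS x : 0 < x -> (x%:E * eGamma x = eGamma (x + 1))%E.
Proof.
move=> x_gt0; pose u k := (x%:E * \int[mu]_(t in window k) (f x t)%:E)%E.
have u_l : u k @[k --> \oo] --> (x%:E * eGamma x)%E by apply: cvgeZl.
suff u_r : u k @[k --> \oo] --> (eGamma (x + 1) + 0)%E.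
  by rewrite -[RHS]adde0; apply: cvg_unique u_l u_r; exact: ereal_hausdorff.
under eq_cvg do rewrite /u window_parts //.
apply: cvgeD; [by rewrite fin_num_adde_defl | exact: window_cvg |].
by apply: cvg_EFin; [exact: nearW | exact: f1_cvg0].
Qed.

(** Split at t = 1: t^x <= 1 below and t^x <= t^n above. *)
Let f1_le x n t : x <= n%:R -> 0 <= x -> 0 < t -> f (x + 1) t <= f 1 t + f n.+1%:R t.
Proof.
move=> le_xn x_ge0 t_gt0; rewrite /f addrK subrr powRr0 -mulrDl ler_wpM2r ?expR_ge0 //.
rewrite -natr1 addrK; have [t_le1|t_gt1] := leP t 1.
  rewrite ler_wpDr ?powR_ge0 // -(powRr0 t).
  by apply: ger_powR => //; rewrite t_gt0.
by rewrite ler_wpDl //; apply: ler_powR => //; apply: ltW.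
Qed.

Let itvoy_gt0 (t : R) : `]0, +oo[%classic t -> 0 < t.
Proof. by rewrite /= in_itv /= andbT. Qed.

Lemma eGamma_ge0 x : (0 <= eGamma x)%E.
Proof. by apply: integral_ge0 => t _; rewrite lee_fin. Qed.

(** The value at 1 is at most the total mass of the exponential law of rate 1; the functional
    equation does the rest. *)
Lemma eGamma_nat n : (eGamma n.+1%:R < +oo)%E.
Proof.
elim: n => [|n IHn]; last first.
  by rewrite -(natr1 n.+1) -eGammaS // lte_mul_pinfty.
apply: (@le_lt_trans _ _ (\int[mu]_t (exponential_pdf 1 t)%:E)%E); last first.
  by rewrite integral_exponential_pdf // ltry.
have -> : eGamma 1 = (\int[mu]_(t in `]0%R, +oo[) (exponential_pdf 1 t)%:E)%E.
  apply: eq_integral => t; rewrite inE => /itvoy_gt0 t_gt0.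
  by rewrite exponential_pdfE ?ltW // /f subrr powRr0 !mul1r mulN1r.
apply: ge0_subset_integral => //.
  by apply/measurable_EFinP; exact: measurable_exponential_pdf.
by move=> t _; rewrite lee_fin exponential_pdf_ge0.
Qed.

(** The functional equation moves the question to [x + 1], where [f1_le] dominates the integrand by
    those of two integer arguments. *)
Lemma eGamma_lty x : 0 < x -> (eGamma x < +oo)%E.
Proof.
move=> x_gt0; suff : (x%:E * eGamma x < +oo)%E.
  by have := eGamma_ge0 x; case: (eGamma x) => // [r _ _|_]; rewrite ?ltry // gt0_muley ?lte_fin.
rewrite eGammaS //; pose n := Num.bound x.
apply: (@le_lt_trans _ _ (eGamma 1 + eGamma n.+1%:R)%E); last first.
  by rewrite lte_add_pinfty // (eGamma_nat 0, eGamma_nat n).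
have f0 y t : `]0%R, +oo[%classic t -> (0 <= (f y t)%:E)%E by rewrite lee_fin.
rewrite /eGamma -ge0_integralD //; do ?[exact: f0 | exact: emeasurable_f].
apply: ge0_le_integral => //.
- exact: f0.
- exact: emeasurable_f.
- by apply: emeasurable_funD; exact: emeasurable_f.
move=> t /itvoy_gt0 t_gt0; rewrite -EFinD lee_fin f1_le ?(ltW x_gt0) //.
by apply/ltW/archi_boundP/ltW.
Qed.

(** After the shift to [x + 1], the integrand is at least e^(-2) on [1, 2]. *)
Lemma eGamma_gt0 x : 0 < x -> (0 < eGamma x)%E.
Proof.
move=> x_gt0; suff : (0 < x%:E * eGamma x)%E by rewrite pmule_rgt0.
rewrite eGammaS //.
apply: (@lt_le_trans _ _ (\int[mu]_(t in `[1%R, 2%R]) (expR (- 2))%:E)%E).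
  rewrite integral_cst //= lebesgue_measure_itv /= lte_fin ltr1n -EFinB -EFinM lte_fin.
  by rewrite mulr_gt0 ?expR_gt0 // subr_gt0 ltr1n.
apply: (@le_trans _ _ (\int[mu]_(t in `[1%R, 2%R]) (f (x + 1) t)%:E)%E).
  apply: ge0_le_integral => //.
  - exact: emeasurable_f.
  move=> t; rewrite /= in_itv /= => /andP[t_ge1 t_le2].
  rewrite lee_fin /f addrK -[leLHS]mul1r ler_pM ?expR_ge0 //; last by rewrite ler_expR lerN2.
  by rewrite -(powRr0 t); apply: ler_powR => //; apply: ltW.
apply: ge0_subset_integral => //.
- exact: emeasurable_f.
- by move=> t _; rewrite lee_fin.
by move=> t; rewrite /= !in_itv /= andbT => /andP[+ _]; apply: lt_le_trans.
Qed.

Lemma Gamma_gt0 x : 0 < x -> 0 < Gamma x.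
Proof. by move=> x_gt0; rewrite /Gamma /Rintegral fine_gt0 // eGamma_gt0 ?eGamma_lty. Qed.

Lemma GammaS x : 0 < x -> Gamma (x + 1) = x * Gamma x.
Proof.
move=> x_gt0; rewrite /Gamma /Rintegral -/(eGamma _) -/(eGamma _) -eGammaS // fineM //.
by rewrite ge0_fin_numE ?eGamma_ge0 ?eGamma_lty.
Qed.

End GammaRecurrence.

(** * Matrices of gamma values *)

Lemma GammaDn (R : realType) (x : R) k : 0 < x ->
  Gamma (x + k%:R) = Gamma x * \prod_(l <- iota 0 k) (x + l%:R).
Proof.
move=> x_gt0; elim: k => [|k IHk]; first by rewrite big_nil addr0 mulr1.
rewrite -natr1 addrA GammaS ?ltr_wpDr // IHk -addn1 iotaD big_cat /= big_seq1.
by rewrite mulrC mulrA.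
Qed.

Lemma prod_flatten_nseq (R : comPzRingType) (T : Type) (F : T -> R) (s : seq T) m :
  \prod_(a <- flatten (nseq m s)) F a = (\prod_(a <- s) F a) ^+ m.
Proof. by elim: m => [|m IHm] /=; rewrite ?big_nil // big_cat /= IHm exprS. Qed.

Lemma unitmx_scale (R : comUnitRingType) n (u v : 'I_n -> R) (A : 'M[R]_n) :
  (forall i, u i \is a GRing.unit) -> (forall j, v j \is a GRing.unit) ->
  A \in unitmx -> \matrix_(i, j) (u i * A i j * v j) \in unitmx.
Proof.
move=> u_unit v_unit A_unit.
have -> : \matrix_(i, j) (u i * A i j * v j) = diag_mx (\row_i u i) *m A *m diag_mx (\row_j v j).
  by apply/matrixP => i j; rewrite mul_mx_diag mul_diag_mx !mxE.
rewrite !unitmx_mul A_unit !unitmxE !det_diag andbT.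
by apply/andP; split; apply: rpred_prod => i _; rewrite mxE.
Qed.

Lemma unitmx_invGammaX (R : realType) m n (lambda mu : 'I_n.+1 -> R) : (0 < m)%N ->
  injective lambda -> (forall i, 0 < lambda i) -> (forall i, 0 < mu i) ->
  (forall i j : 'I_n.+1, j = i.+1 :> nat ->
     exists k : nat, (0 < k)%N /\ mu j - mu i = k%:R) ->
  \matrix_(i, j) (Gamma (lambda i + mu j) ^+ m)^-1 \in unitmx.
Proof.
move=> m_gt0 lambda_inj lambda_gt0 mu_gt0 mu_step.
(* [chain] is indexed by [nat], so the gaps become a function on [nat], with junk value 0 from [n]
   on, and [mu] is read through [inord]. *)
have /choice[k kP] : forall j, exists kj : nat, (j < n)%N ->
    (0 < kj)%N /\ mu (inord j.+1) = mu (inord j) + kj%:R.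
  move=> j.
  have [lt_jn|] := boolP (j < n)%N; last by exists 0%N.
  have [|k [k_gt0 Dk]] := mu_step (inord j) (inord j.+1).
    by rewrite !inordK // ltnW.
  by exists k => _; rewrite -Dk addrC subrK.
(* Raising to the power [m] repeats each linear factor of the gamma quotient [m] times. *)
pose s j := flatten (nseq m [seq mu (inord j) + l%:R | l <- iota 0 (k j)]).
pose g i j := Gamma (lambda i + mu (inord j)) ^+ m.
have -> : \matrix_(i, j) (Gamma (lambda i + mu j) ^+ m)^-1 =
          \matrix_(i < n.+1, j < n.+1) (g i j)^-1.
  by apply/matrixP => i j; rewrite !mxE /g inord_val.
apply: (@unitmx_chain _ _ lambda s) => // [j lt_jn|j lt_jn|i j _|i j lt_jn].
- have [k_gt0 _] := kP j lt_jn; rewrite /s size_flatten /shape map_nseq sumn_nseq.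
  by rewrite size_map size_iota muln_gt0 k_gt0.
- apply/allP => a /flattenP[t]; rewrite mem_nseq => /andP[_ /eqP->] /mapP[l _ ->].
  by rewrite /= ltr_wpDr.
- by rewrite expf_neq0 // gt_eqF // Gamma_gt0 // addr_gt0.
have [_ muS] := kP j lt_jn.
rewrite /g muS prod_flatten_nseq -exprMn addrA GammaDn ?addr_gt0 // big_map.
by under [in RHS]eq_bigr do rewrite addrA.
Qed.

Theorem theorem3p1 (R : realType) (m n : nat) (hm : (0 < m)%N) (hn : (0 < n)%N)
  (lambda mu : 'I_n -> R)
  (lambda_gt0 : forall i : 'I_n, 0 < lambda i)
  (lambda_incr : forall i j : 'I_n, (i < j)%N -> lambda i < lambda j)
  (mu_gt0 : forall i : 'I_n, 0 < mu i)
  (mu_incr : forall i j : 'I_n, (i < j)%N -> mu i < mu j)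
  (mu_step : forall i j : 'I_n, j = i.+1 :> nat ->
     exists k : nat, (0 < k)%N /\ mu j - mu i = k%:R) :
  (\matrix_(i < n, j < n) (1 / Gamma (lambda i + mu j) ^+ m)) \in unitmx /\
  (\matrix_(i < n, j < n) (Beta (lambda i) (mu j) ^+ m)) \in unitmx.
Proof.
case: n hn lambda mu lambda_gt0 lambda_incr mu_gt0 mu_incr mu_step => // n _ lambda mu.
move=> lambda_gt0 lambda_incr mu_gt0 _ mu_step.
have lambda_inj : injective lambda.
  move=> i j eq_ij; have [lt_ij|lt_ji|/val_inj//] := ltngtP (i : nat) j.
    by have := lambda_incr _ _ lt_ij; rewrite eq_ij ltxx.
  by have := lambda_incr _ _ lt_ji; rewrite eq_ij ltxx.
have unit1 := unitmx_invGammaX hm lambda_inj lambda_gt0 mu_gt0 mu_step.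
split.
  by under eq_mx do rewrite div1r.
have Gamma_unit (x : 'I_n.+1 -> R) : (forall i, 0 < x i) ->
    forall i, Gamma (x i) ^+ m \is a GRing.unit.
  by move=> x_gt0 i; rewrite unitfE expf_neq0 // gt_eqF // Gamma_gt0.
(* Row factors [Gamma (lambda i) ^+ m], column factors [Gamma (mu j) ^+ m]. *)
have := unitmx_scale (Gamma_unit _ lambda_gt0) (Gamma_unit _ mu_gt0) unit1.
congr (is_true (_ \in unitmx)); apply/matrixP => i j; rewrite !mxE.
by rewrite /Beta expr_div_n exprMn mulrAC.
Qed.
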